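(* Assume $q$ is not a root of unity. Let $V$ be a finite-dimensional irreducible $\mathcal A$-module. Let $0\ne v_0\in V$ be such that $\nu_yv_0=0$ and $v_0$ is a common eigenvector for $z^2$ and $\nu_y\nu_x$; put $v_i=\nu_x^iv_0$ for $i\in\mathbb N$, and let $d\in\mathbb N$ be maximal such that $v_d\neq0$. Then the $\mathcal A$-module $V$ is isomorphic to the $\mathcal A$-module $L(d)$. An isomorphism $V\to L(d)$ is given by $v_i\mapsto\gamma_iu_i$ for $0\le i\le d$, where $\gamma_0=1$ and $\gamma_{i+1}/\gamma_i=q^{-1}(1-q^{2(i+1)})$ for $0\le i\le d-1$.
   Context: $\mathbb K$ is a field and $q$ is a nonzero scalar in $\mathbb K$ that is not a root of unity (in particular $q^2\ne1$). $\mathbb N=\{0,1,2,\ldots\}$. $U_q(\mathfrak{sl}_2)$ is the unital associative $\mathbb K$-algebra with generators $x,y,y^{-1},z$ and relations $yy^{-1}=y^{-1}y=1$, $\frac{qxy-q^{-1}yx}{q-q^{-1}}=1$, $\frac{qyz-q^{-1}zy}{q-q^{-1}}=1$, $\frac{qzx-q^{-1}xz}{q-q^{-1}}=1$. $\mathcal A$ is the $\mathbb K$-subalgebra of $U_q(\mathfrak{sl}_2)$ spanned by $x^ry^sz^t$ with $r,s,t\in\mathbb N$ and $r+s+t$ even. It contains (and is generated by) $\nu_x=q(1-yz)=q^{-1}(1-zy)$, $\nu_y=q(1-zx)=q^{-1}(1-xz)$, $\nu_z=q(1-xy)=q^{-1}(1-yx)$. For every finite-dimensional irreducible $\mathcal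 A$-module $V$, a vector $v_0$ as in the claim exists, the action of $\nu_x$ on $V$ is nilpotent (so $d$ is well defined), and $\{v_i\}_{i=0}^d$ is a basis of $V$. For $d\in\mathbb N$ and $\epsilon\in\{1,-1\}$, $L(d,\epsilon)$ is the (known, irreducible) $U_q(\mathfrak{sl}_2)$-module with basis $\{u_i\}_{i=0}^d$ such that for $0\le i\le d$: $(\epsilon x-q^{d-2i})u_i=(q^{-d}-q^{d-2i+2})u_{i-1}$, $(\epsilon y-q^{d-2i})u_i=(q^d-q^{d-2i-2})u_{i+1}$, $\epsilon z u_i=q^{2i-d}u_i$, where $u_{-1}=u_{d+1}=0$. The restrictions to $\mathcal A$ of $L(d,1)$ and $L(d,-1)$ are isomorphic via $u_i\mapsto u_i$; identifying them, the resulting $\mathcal A$-module with basis $\{u_i\}_{i=0}^d$ is denoted $L(d)$ (so $L(d)$ is $L(d,1)$ restricted to $\mathcal A$). *)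

(* Defs.v *)
From HB Require Import structures.
From mathcomp Require Import all_boot all_order all_algebra.
From mathcomp Require Import ring zify.
From mathcomp Require Import boolp.

Set Implicit Arguments.
Unset Strict Implicit.
Unset Printing Implicit Defensive.

Import Order.TTheory GRing.Theory Num.Theory.
Local Open Scope ring_scope.
Local Open Scope quotient_scope.

Record nonroot (K : fieldType) := Nonroot {
  qval :> K;
  nonroot_neq0 : qval != 0;
  nonroot_expn : forall n : nat, (0 < n)%N -> qval ^+ n != 1
}.

(* U_q(sl_2) is presented as formal expressions in the four generators and the
   scalars, modulo the smallest congruence containing the axioms of unital
   associative K-algebras and the defining relations. *)
Inductive term (K : Type) : Type :=
| TX | TY | TYi | TZ
| TC of K
| TAdd of term K & term K
| TMul of term K & term K.

Arguments TX {K}.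
Arguments TY {K}.
Arguments TYi {K}.
Arguments TZ {K}.

HB.instance Definition _ (K : Type) := gen_eqMixin (term K).
HB.instance Definition _ (K : Type) := gen_choiceMixin (term K).

Inductive cong (K : fieldType) (q : K) : term K -> term K -> Prop :=
| cong_refl s : cong q s s
| cong_sym s t : cong q s t -> cong q t s
| cong_trans s t u : cong q s t -> cong q t u -> cong q s u
| cong_add s s' t t' :
    cong q s s' -> cong q t t' -> cong q (TAdd s t) (TAdd s' t')
| cong_mul s s' t t' :
    cong q s s' -> cong q t t' -> cong q (TMul s t) (TMul s' t')
| cong_addA s t u : cong q (TAdd s (TAdd t u)) (TAdd (TAdd s t) u)
| cong_addC s t : cong q (TAdd s t) (TAdd t s)
| cong_add0 s : cong q (TAdd (TC 0) s) s
| cong_addN s : cong q (TAdd (TMul (TC (-1)) s) s) (TC 0)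
| cong_mulA s t u : cong q (TMul s (TMul t u)) (TMul (TMul s t) u)
| cong_mul1l s : cong q (TMul (TC 1) s) s
| cong_mulDl s t u :
    cong q (TMul (TAdd s t) u) (TAdd (TMul s u) (TMul t u))
| cong_mulDr s t u :
    cong q (TMul s (TAdd t u)) (TAdd (TMul s t) (TMul s u))
| cong_scalarD a b : cong q (TAdd (TC a) (TC b)) (TC (a + b))
| cong_scalarM a b : cong q (TMul (TC a) (TC b)) (TC (a * b))
| cong_central a s : cong q (TMul (TC a) s) (TMul s (TC a))
| cong_yyi : cong q (TMul TY TYi) (TC 1)
| cong_yiy : cong q (TMul TYi TY) (TC 1)
| cong_xy : cong q
    (TMul (TC (q - q^-1)^-1)
      (TAdd (TMul (TC q) (TMul TX TY)) (TMul (TC (- q^-1)) (TMul TY TX))))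
    (TC 1)
| cong_yz : cong q
    (TMul (TC (q - q^-1)^-1)
      (TAdd (TMul (TC q) (TMul TY TZ)) (TMul (TC (- q^-1)) (TMul TZ TY))))
    (TC 1)
| cong_zx : cong q
    (TMul (TC (q - q^-1)^-1)
      (TAdd (TMul (TC q) (TMul TZ TX)) (TMul (TC (- q^-1)) (TMul TX TZ))))
    (TC 1).

Section Congruence.
Variables (K : fieldType) (q : K).

Definition congb : rel (term K) := fun s t => `[< cong q s t >].

Lemma congb_equiv : equiv_class_of congb.
Proof.
split=> [s|s t|t s u].
- exact/asboolP/cong_refl.
- by apply/asboolP/asboolP; apply: cong_sym.
- by move=> /asboolP st /asboolP tu; apply/asboolP; apply: cong_trans st tu.
Qed.

Canonical congb_equiv_rel := EquivRelPack congb_equiv.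

End Congruence.

Definition Uq (K : fieldType) (q : nonroot K) : Type :=
  {eq_quot (congb_equiv_rel (qval q))}.

HB.instance Definition _ (K : fieldType) (q : nonroot K) := Choice.on (Uq q).
HB.instance Definition _ (K : fieldType) (q : nonroot K) :=
  EqQuotient.on (Uq q).

HB.lock Definition Uadd (K : fieldType) (q : nonroot K) (u v : Uq q) : Uq q :=
  \pi_(Uq q) (TAdd (repr u) (repr v)).
HB.lock Definition Umul (K : fieldType) (q : nonroot K) (u v : Uq q) : Uq q :=
  \pi_(Uq q) (TMul (repr u) (repr v)).
HB.lock Definition Uscalar (K : fieldType) (q : nonroot K) (c : K) : Uq q :=
  \pi_(Uq q) (TC c).
HB.lock Definition Uscale (K : fieldType) (q : nonroot K) (c : K) (u : Uq q) :
  Uq q := Umul (Uscalar q c) u.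

Section UqStructure.
Variables (K : fieldType) (q : nonroot K).

Local Notation U := (Uq q).
Local Notation Q := (qval q).
Local Notation "\p t" := (\pi_U t) (at level 9, t at level 9).

Lemma UqE (s t : term K) : \p s = \p t <-> cong Q s t.
Proof.
split; first by move=> /eqmodP/asboolP.
by move=> st; apply/eqmodP/asboolP.
Qed.

Lemma cong_repr s : cong Q (repr \p s) s.
Proof. by apply/UqE; rewrite reprK. Qed.

Lemma UaddE s t : Uadd \p s \p t = \p (TAdd s t).
Proof. rewrite Uadd.unlock; by apply/UqE; apply: cong_add; apply: cong_repr. Qed.

Lemma UmulE s t : Umul \p s \p t = \p (TMul s t).
Proof. rewrite Umul.unlock; by apply/UqE; apply: cong_mul; apply: cong_repr. Qed.

Lemma UconstE c : Uscalar q c = \p (TC c).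
Proof. by rewrite Uscalar.unlock. Qed.

Lemma Uind (P : U -> Prop) : (forall t, P \p t) -> forall u, P u.
Proof. by move=> Pp u; rewrite -[u]reprK; apply: Pp. Qed.

Lemma UaddA : associative (@Uadd K q).
Proof.
elim/Uind=> s; elim/Uind=> t; elim/Uind=> u.
by rewrite !UaddE; apply/UqE/cong_addA.
Qed.

Lemma UaddC : commutative (@Uadd K q).
Proof.
by elim/Uind=> s; elim/Uind=> t; rewrite !UaddE; apply/UqE/cong_addC.
Qed.

Lemma Uadd0 : left_id (Uscalar q 0) (@Uadd K q).
Proof. by elim/Uind=> s; rewrite UconstE UaddE; apply/UqE/cong_add0. Qed.

Lemma UaddN : left_inverse (Uscalar q 0) (Umul (Uscalar q (-1))) (@Uadd K q).
Proof. by elim/Uind=> s; rewrite !UconstE UmulE UaddE; apply/UqE/cong_addN. Qed.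

HB.instance Definition _ := GRing.isZmodule.Build U UaddA UaddC Uadd0 UaddN.

Lemma UmulA : associative (@Umul K q).
Proof.
elim/Uind=> s; elim/Uind=> t; elim/Uind=> u.
by rewrite !UmulE; apply/UqE/cong_mulA.
Qed.

Lemma Umul1l : left_id (Uscalar q 1) (@Umul K q).
Proof. by elim/Uind=> s; rewrite UconstE UmulE; apply/UqE/cong_mul1l. Qed.

Lemma Ucentral c u : Umul (Uscalar q c) u = Umul u (Uscalar q c).
Proof. by elim/Uind: u => s; rewrite UconstE !UmulE; apply/UqE/cong_central. Qed.

Lemma Umul1r : right_id (Uscalar q 1) (@Umul K q).
Proof. by move=> u; rewrite -Ucentral Umul1l. Qed.

Lemma UmulDl : left_distributive (@Umul K q) (@Uadd K q).
Proof.
elim/Uind=> s; elim/Uind=> t; elim/Uind=> u.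
by rewrite !(UmulE, UaddE); apply/UqE/cong_mulDl.
Qed.

Lemma UmulDr : right_distributive (@Umul K q) (@Uadd K q).
Proof.
elim/Uind=> s; elim/Uind=> t; elim/Uind=> u.
by rewrite !(UmulE, UaddE); apply/UqE/cong_mulDr.
Qed.

Lemma nonroot_subV_neq0 : Q - Q^-1 != 0.
Proof.
have q0 := nonroot_neq0 q; rewrite subr_eq0.
apply: contra (nonroot_expn q (ltn0Sn 1)) => /eqP qV.
by rewrite expr2 {2}qV mulfV.
Qed.

Section Eval.
Variables (B : algType K) (bx bY byi bz : B).

Fixpoint teval (t : term K) : B :=
  match t with
  | TX => bx | TY => bY | TYi => byi | TZ => bz
  | TC c => c%:A
  | TAdd s t => teval s + teval t
  | TMul s t => teval s * teval t
  end.

Definition Uq_relations : Prop :=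
  [/\ bY * byi = 1, byi * bY = 1,
      (Q - Q^-1)^-1 *: (Q *: (bx * bY) - Q^-1 *: (bY * bx)) = 1,
      (Q - Q^-1)^-1 *: (Q *: (bY * bz) - Q^-1 *: (bz * bY)) = 1 &
      (Q - Q^-1)^-1 *: (Q *: (bz * bx) - Q^-1 *: (bx * bz)) = 1].

Lemma teval_cong s t : Uq_relations -> cong Q s t -> teval s = teval t.
Proof.
move=> [yyi yiy xy yz zx]; elim=> {s t} //=.
- by move=> s t u _ -> _ ->.
- by move=> s s' t t' _ -> _ ->.
- by move=> s s' t t' _ -> _ ->.
- by move=> s t u; rewrite addrA.
- by move=> s t; rewrite addrC.
- by move=> s; rewrite scale0r add0r.
- by move=> s; rewrite mulr_algl scaleN1r addNr scale0r.
- by move=> s t u; rewrite mulrA.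
- by move=> s; rewrite mulr_algl scale1r.
- by move=> s t u; rewrite mulrDl.
- by move=> s t u; rewrite mulrDr.
- by move=> a b; rewrite scalerDl.
- by move=> a b; rewrite mulr_algl scalerA.
- by move=> a s; rewrite mulr_algl mulr_algr.
- by rewrite scale1r.
- by rewrite scale1r.
- by rewrite !mulr_algl scaleNr scale1r.
- by rewrite !mulr_algl scaleNr scale1r.
- by rewrite !mulr_algl scaleNr scale1r.
Qed.

End Eval.

Lemma Uone_neq0 : Uscalar q 1 != Uscalar q 0.
Proof.
apply/eqP; rewrite !UconstE => /UqE/(@teval_cong K^o 1 1 1 1).
rewrite /Uq_relations /= !mulr1 => H.
have/H : [/\ (1 : K^o) = 1, (1 : K^o) = 1,
   (Q - Q^-1)^-1 *: (Q *: (1 : K^o) - Q^-1 *: (1 : K^o)) = 1,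
   (Q - Q^-1)^-1 *: (Q *: (1 : K^o) - Q^-1 *: (1 : K^o)) = 1 &
   (Q - Q^-1)^-1 *: (Q *: (1 : K^o) - Q^-1 *: (1 : K^o)) = 1].
  by rewrite -scalerBl scalerA mulVf ?nonroot_subV_neq0 ?scale1r.
by rewrite scale1r scale0r => /eqP; rewrite oner_eq0.
Qed.

HB.instance Definition _ := GRing.Zmodule_isNzRing.Build U
  UmulA Umul1l Umul1r UmulDl UmulDr Uone_neq0.

Lemma UscalarD a b : Uscalar q (a + b) = Uscalar q a + Uscalar q b.
Proof.
by rewrite !UconstE [RHS]UaddE; apply/UqE/cong_sym; apply: cong_scalarD.
Qed.

Lemma UscalarM a b : Uscalar q (a * b) = Uscalar q a * Uscalar q b.
Proof.
by rewrite !UconstE [RHS]UmulE; apply/UqE/cong_sym; apply: cong_scalarM.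
Qed.

Lemma UscaleE c u : Uscale c u = Uscalar q c * u.
Proof. by rewrite Uscale.unlock. Qed.

Lemma UscaleA a b u : Uscale a (Uscale b u) = @Uscale K q (a * b) u.
Proof. by rewrite !UscaleE mulrA UscalarM. Qed.

Lemma Uscale1 : left_id 1 (@Uscale K q).
Proof. by move=> u; rewrite UscaleE [LHS]mul1r. Qed.

Lemma UscaleDr : right_distributive (@Uscale K q) +%R.
Proof. by move=> a u v; rewrite !UscaleE mulrDr. Qed.

Lemma UscaleDl u : {morph (@Uscale K q)^~ u : a b / a + b}.
Proof. by move=> a b; rewrite !UscaleE UscalarD mulrDl. Qed.

HB.instance Definition _ := GRing.Zmodule_isLmodule.Build K U
  UscaleA Uscale1 UscaleDr UscaleDl.

Lemma UscaleAl (a : K) (u v : U) : a *: (u * v) = a *: u * v.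
Proof. by rewrite ![_ *: _]UscaleE [LHS]mulrA. Qed.

HB.instance Definition _ := GRing.Lmodule_isLalgebra.Build K U UscaleAl.

Lemma UscaleAr (a : K) (u v : U) : a *: (u * v) = u * (a *: v).
Proof.
rewrite ![_ *: _]UscaleE !mulrA; congr (_ * v); exact: Ucentral.
Qed.

HB.instance Definition _ := GRing.Lalgebra_isAlgebra.Build K U UscaleAr.

Definition Ux : U := \p TX.
Definition Uy : U := \p TY.
Definition Uyi : U := \p TYi.
Definition Uz : U := \p TZ.

Lemma UscalarE c : Uscalar q c = c%:A.
Proof. by rewrite ![_ *: _]UscaleE [RHS]mulr1. Qed.

Lemma Uq_relationsP : Uq_relations Ux Uy Uyi Uz.
Proof.
have scE c t : c *: (\p t : U) = \p (TMul (TC c) t).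
  by rewrite [LHS]UscaleE UconstE [LHS]UmulE.
have addE s t : (\p s : U) + \p t = \p (TAdd s t) by exact: UaddE.
have mulE s t : (\p s : U) * \p t = \p (TMul s t) by exact: UmulE.
have oE : 1 = \p (TC 1) by exact: UconstE.
rewrite /Uq_relations -!scaleNr !oE !(scE, addE, mulE).
split; apply/UqE.
- exact: cong_yyi.
- exact: cong_yiy.
- exact: cong_xy.
- exact: cong_yz.
- exact: cong_zx.
Qed.

Section Lift.
Variables (B : algType K) (bx bY byi bz : B).
Hypothesis rel : Uq_relations bx bY byi bz.

Definition Ulift of Uq_relations bx bY byi bz :=
  fun u : U => teval bx bY byi bz (repr u).
Local Notation f := (Ulift rel).

Lemma UliftE t : f \p t = teval bx bY byi bz t.
Proof. exact: teval_cong rel (cong_repr t). Qed.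

Lemma Ulift_zmod : zmod_morphism f.
Proof.
elim/Uind=> s; elim/Uind=> t.
have -> : \p s - \p t = \p (TAdd s (TMul (TC (-1)) t)).
  by rewrite -UaddE -UmulE -UconstE.
by rewrite !UliftE /= mulr_algl scaleN1r.
Qed.

Lemma Ulift_monoid : monoid_morphism f.
Proof.
split.
  have -> : (1 : U) = \p (TC 1) by exact: UconstE.
  by rewrite UliftE /= scale1r.
elim/Uind=> s; elim/Uind=> t.
have -> : \p s * \p t = \p (TMul s t) :> U by apply: UmulE.
by rewrite !UliftE.
Qed.

Lemma Ulift_scalable : scalable f.
Proof.
move=> a; elim/Uind=> s.
have -> : a *: (\p s : U) = \p (TMul (TC a) s).
  by rewrite [LHS]UscaleE UconstE [LHS]UmulE.
by rewrite !UliftE /= mulr_algl.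
Qed.

HB.instance Definition _ := GRing.isZmodMorphism.Build U B f Ulift_zmod.
HB.instance Definition _ := GRing.isMonoidMorphism.Build U B f Ulift_monoid.
HB.instance Definition _ := GRing.isScalable.Build K U B *:%R f Ulift_scalable.

Lemma Ulift_x : f Ux = bx. Proof. exact: UliftE. Qed.
Lemma Ulift_y : f Uy = bY. Proof. exact: UliftE. Qed.
Lemma Ulift_yi : f Uyi = byi. Proof. exact: UliftE. Qed.
Lemma Ulift_z : f Uz = bz. Proof. exact: UliftE. Qed.

End Lift.

Definition Umon (m : nat * nat * nat) : U :=
  let: (r, s, t) := m in Ux ^+ r * Uy ^+ s * Uz ^+ t.
Definition deg3 (m : nat * nat * nat) : nat :=
  let: (r, s, t) := m in (r + s + t)%N.

(* The linear span of the x^r y^s z^t whose degree r + s + t has parity b. *)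
Definition parity_span (b : bool) (u : U) : Prop :=
  exists l : seq (K * (nat * nat * nat)),
    u = \sum_(p <- l | odd (deg3 p.2) == b) p.1 *: Umon p.2.

Lemma parity_span_mon b m : odd (deg3 m) = b -> parity_span b (Umon m).
Proof.
by move=> mb; exists [:: (1, m)]; rewrite big_cons big_nil /= mb eqxx scale1r
  addr0.
Qed.

Lemma parity_span0 b : parity_span b 0.
Proof. by exists [::]; rewrite big_nil. Qed.

Lemma parity_spanP b a u v :
  parity_span b u -> parity_span b v -> parity_span b (a *: u + v).
Proof.
move=> [l ->] [k ->]; exists ([seq (a * p.1, p.2) | p <- l] ++ k).
rewrite big_cat big_map /= scaler_sumr; congr (_ + _).
by apply: eq_bigr => p _; rewrite scalerA.
Qed.

Lemma parity_span_lin b (g : U -> U) c : linear g ->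
  (forall m, odd (deg3 m) = b -> parity_span c (g (Umon m))) ->
  forall u, parity_span b u -> parity_span c (g u).
Proof.
move=> glin gm u [l ->].
have g0 : g 0 = 0.
  by have := glin (-1) 0 0; rewrite scaler0 addr0 scaleN1r addNr.
elim: l => [|p l IHl]; first by rewrite big_nil g0; apply: parity_span0.
rewrite big_cons; case: eqP => // pb.
by rewrite glin; apply: parity_spanP IHl; apply: gm.
Qed.

Lemma mull_linear (w : U) : linear ( *%R w).
Proof. by move=> a u v; rewrite mulrDr scalerAr. Qed.

Lemma Uyx : Uy * Ux = Q ^+ 2 *: (Ux * Uy) + (1 - Q ^+ 2) *: 1.
Proof.
have [_ _ xy _ _] := Uq_relationsP; have q0 := nonroot_neq0 q.
have w := nonroot_subV_neq0.
have: Q *: ((Q - Q^-1) *: ((Q - Q^-1)^-1 *: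
    (Q *: (Ux * Uy) - Q^-1 *: (Uy * Ux)))) = Q *: ((Q - Q^-1) *: 1).
  by rewrite xy.
rewrite scalerA [_ *: _]scalerA -mulrA mulfV // mulr1 scalerBr !scalerA.
rewrite mulfV // scale1r mulrBr mulfV // -expr2 => e.
by rewrite -[1 - _]opprB scaleNr -e opprB addrC subrK.
Qed.

Lemma Uzy : Uz * Uy = Q ^+ 2 *: (Uy * Uz) + (1 - Q ^+ 2) *: 1.
Proof.
have [_ _ _ yz _] := Uq_relationsP; have q0 := nonroot_neq0 q.
have w := nonroot_subV_neq0.
have: Q *: ((Q - Q^-1) *: ((Q - Q^-1)^-1 *:
    (Q *: (Uy * Uz) - Q^-1 *: (Uz * Uy)))) = Q *: ((Q - Q^-1) *: 1).
  by rewrite yz.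
rewrite scalerA [_ *: _]scalerA -mulrA mulfV // mulr1 scalerBr !scalerA.
rewrite mulfV // scale1r mulrBr mulfV // -expr2 => e.
by rewrite -[1 - _]opprB scaleNr -e opprB addrC subrK.
Qed.

Lemma Uzx : Uz * Ux = Q ^- 2 *: (Ux * Uz) + (1 - Q ^- 2) *: 1.
Proof.
have [_ _ _ _ zx] := Uq_relationsP; have q0 := nonroot_neq0 q.
have w := nonroot_subV_neq0.
have: Q^-1 *: ((Q - Q^-1) *: ((Q - Q^-1)^-1 *:
    (Q *: (Uz * Ux) - Q^-1 *: (Ux * Uz)))) = Q^-1 *: ((Q - Q^-1) *: 1).
  by rewrite zx.
rewrite scalerA [_ *: _]scalerA -mulrA mulfV // mulr1 scalerBr !scalerA.
rewrite mulVf // scale1r mulrBr mulVf // -expr2 exprVn => e.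
by rewrite -e addrC subrK.
Qed.

Lemma parity_span_x b u : parity_span b u -> parity_span (~~ b) (Ux * u).
Proof.
apply: parity_span_lin => [|[[r s] t] /= e]; first exact: mull_linear.
rewrite !mulrA -exprS; apply: (@parity_span_mon _ (r.+1, s, t)).
by rewrite /= -e.
Qed.

Lemma parity_span_y b u : parity_span b u -> parity_span (~~ b) (Uy * u).
Proof.
apply: parity_span_lin => [|[[r s] t]]; first exact: mull_linear.
elim: r b => [|r IHr] b e.
  rewrite /Umon expr0 mul1r mulrA -exprS -[Uy ^+ _]mul1r -(expr0 Ux).
  by apply: (@parity_span_mon _ (0%N, s.+1, t)); rewrite /= -e /=.
have -> : Uy * Umon (r.+1, s, t) =
    Q ^+ 2 *: (Ux * (Uy * Umon (r, s, t))) + ((1 - Q ^+ 2) *: Umon (r, s, t) + 0).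
  by rewrite /Umon exprS !mulrA Uyx addr0 !mulrDl -!scalerAl !mul1r.
have {}e : odd (deg3 (r, s, t)) = ~~ b by rewrite -e /= negbK.
apply: parity_spanP.
  by apply: parity_span_x; have := IHr _ e; rewrite negbK.
by apply: parity_spanP (parity_span0 _); apply: parity_span_mon.
Qed.

Lemma parity_span_z b u : parity_span b u -> parity_span (~~ b) (Uz * u).
Proof.
apply: parity_span_lin => [|[[r s] t]]; first exact: mull_linear.
elim: r b => [|r IHr] b e; last first.
  have -> : Uz * Umon (r.+1, s, t) = Q ^- 2 *: (Ux * (Uz * Umon (r, s, t))) +
      ((1 - Q ^- 2) *: Umon (r, s, t) + 0).
    by rewrite /Umon exprS !mulrA Uzx addr0 !mulrDl -!scalerAl !mul1r.
  have {}e : odd (deg3 (r, s, t)) = ~~ b by rewrite -e /= negbK.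
  apply: parity_spanP.
  by apply: parity_span_x; have := IHr _ e; rewrite negbK.
  by apply: parity_spanP (parity_span0 _); apply: parity_span_mon.
elim: s b e => [|s IHs] b e.
  rewrite /Umon !expr0 !mul1r -exprS -[Uz ^+ _]mul1r -[1]mulr1.
  rewrite -{1}(expr0 Ux) -(expr0 Uy).
  by apply: (@parity_span_mon _ (0%N, 0%N, t.+1)); rewrite /= -e.
have -> : Uz * Umon (0%N, s.+1, t) =
    Q ^+ 2 *: (Uy * (Uz * Umon (0%N, s, t))) +
    ((1 - Q ^+ 2) *: Umon (0%N, s, t) + 0).
  by rewrite /Umon expr0 !mul1r exprS !mulrA Uzy addr0 !mulrDl -!scalerAl !mul1r.
have {}e : odd (deg3 (0%N, s, t)) = ~~ b by rewrite -e /= negbK.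
apply: parity_spanP.
  by apply: parity_span_y; have := IHs _ e; rewrite negbK.
by apply: parity_spanP (parity_span0 _); apply: parity_span_mon.
Qed.

Lemma parity_spanX (w : U) n b u :
  (forall c v, parity_span c v -> parity_span (~~ c) (w * v)) ->
  parity_span b u -> parity_span (odd n (+) b) (w ^+ n * u).
Proof.
move=> wP bu; elim: n => [|n IHn]; first by rewrite mul1r.
by rewrite exprS -mulrA /= addNb; apply: wP.
Qed.

Lemma parity_spanM b c u v :
  parity_span b u -> parity_span c v -> parity_span (b (+) c) (u * v).
Proof.
move=> bu cv; move: u bu; apply: parity_span_lin.
  by move=> a u w; rewrite mulrDl scalerAl.
move=> [[r s] t] /= <-; rewrite !oddD -!mulrA -!addbA.
apply: parity_spanX; first exact: parity_span_x.
apply: parity_spanX; first exact: parity_span_y.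
by apply: parity_spanX; first exact: parity_span_z.
Qed.

Definition Apred : {pred U} := fun u => `[< parity_span false u >].

Lemma Apred_subalg : subalg_closed Apred.
Proof.
split.
- apply/asboolP; have := @parity_span_mon false (0, 0, 0)%N erefl.
  by rewrite /= !mulr1.
- by move=> a u v /asboolP uA /asboolP vA; apply/asboolP/parity_spanP.
- move=> u v /asboolP uA /asboolP vA; apply/asboolP.
  exact: parity_spanM uA vA.
Qed.

HB.instance Definition _ :=
  GRing.isSubalgClosed.Build K U Apred Apred_subalg.

End UqStructure.

Arguments Apred {K} q u.

Definition calA (K : fieldType) (q : nonroot K) : Type :=
  {u : Uq q | u \in Apred q}.

Section CalA.
Variables (K : fieldType) (q : nonroot K).
Local Notation x := (Ux q).
Local Notation y := (Uy q).
Local Notation z := (Uz q).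

HB.instance Definition _ := SubChoice.on (calA q).
HB.instance Definition _ := [SubChoice_isSubAlgebra of calA q by <:].

Lemma Apred_mon2 (u v : Uq q) :
  u \in [:: x; y; z] -> v \in [:: x; y; z] -> u * v \in Apred q.
Proof.
have gen w : w \in [:: x; y; z] -> parity_span true w.
  rewrite !inE => /or3P[]/eqP->.
  - by have := @parity_span_mon _ q true (1, 0, 0)%N erefl; rewrite /= !mulr1.
  - have := @parity_span_mon _ q true (0, 1, 0)%N erefl.
    by rewrite /= mulr1 mul1r.
  - by have := @parity_span_mon _ q true (0, 0, 1)%N erefl; rewrite /= !mul1r.
by move=> /gen uT /gen vT; apply/asboolP; apply: parity_spanM uT vT.
Qed.

Lemma nu_in (u v : Uq q) : u \in [:: x; y; z] -> v \in [:: x; y; z] ->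
  qval q *: (1 - u * v) \in Apred q.
Proof. by move=> ux vx; rewrite rpredZ ?rpredB ?rpred1 ?Apred_mon2. Qed.

Fact nu_x_in : qval q *: (1 - y * z) \in Apred q.
Proof. by apply: nu_in; rewrite !inE eqxx ?orbT. Qed.
Fact nu_y_in : qval q *: (1 - z * x) \in Apred q.
Proof. by apply: nu_in; rewrite !inE eqxx ?orbT. Qed.
Fact sqr_z_in : z ^+ 2 \in Apred q.
Proof. by rewrite expr2; apply: Apred_mon2; rewrite !inE eqxx ?orbT. Qed.

Definition nu_x : calA q := Sub (qval q *: (1 - y * z)) nu_x_in.
Definition nu_y : calA q := Sub (qval q *: (1 - z * x)) nu_y_in.
Definition sqr_z : calA q := Sub (z ^+ 2) sqr_z_in.

(* The scalars of K act on an A-module through c |-> c%:A. *)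
Definition finite_dimensional (V : lmodType (calA q)) : Prop :=
  exists (n : nat) (e : 'I_n -> V), forall v : V,
    exists c : 'I_n -> K, v = \sum_(i < n) (c i)%:A *: e i.

Definition irreducible_module (V : lmodType (calA q)) : Prop :=
  (exists v : V, v != 0) /\
  forall W : {pred V}, submod_closed W ->
    (forall v, v \in W -> v = 0) \/ (forall v, v \in W).

Definition eigenvector (V : lmodType (calA q)) (a : calA q) (v : V) : Prop :=
  v != 0 /\ exists c : K, a *: v = c%:A *: v.

End CalA.

Definition restriction (K : fieldType) (q : nonroot K) (M : lmodType (Uq q)) :
  Type := M.

Section Restriction.
Variables (K : fieldType) (q : nonroot K) (M : lmodType (Uq q)).
Local Notation N := (restriction M).

HB.instance Definition _ := GRing.Zmodule.on N.

Definition restr_scale (a : calA q) (v : N) : N := \val a *: (v : M).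

Lemma restr_scaleA a b v :
  restr_scale a (restr_scale b v) = restr_scale (a * b) v.
Proof. by rewrite /restr_scale scalerA rmorphM. Qed.

Lemma restr_scale1 : left_id 1 restr_scale.
Proof. by move=> v; rewrite /restr_scale rmorph1 scale1r. Qed.

Lemma restr_scaleDr : right_distributive restr_scale +%R.
Proof. by move=> a u v; apply: scalerDr. Qed.

Lemma restr_scaleDl v : {morph restr_scale^~ v : a b / a + b}.
Proof. by move=> a b; rewrite /restr_scale rmorphD scalerDl. Qed.

HB.instance Definition _ := GRing.Zmodule_isLmodule.Build (calA q) N
  restr_scaleA restr_scale1 restr_scaleDr restr_scaleDl.

End Restriction.

Section LMatrices.
Variables (K : fieldType) (q : nonroot K) (d : nat).
Local Notation Q := (qval q).

(* The basis vector u_i for 0 <= i <= d, and 0 for any other integer i. *)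
Definition Lvec (i : int) : 'cV[K]_d.+1 := \col_j ((j%:Z == i)%:R).

(* The operators x, y, z of L(d, 1): column j is the image of u_j. *)
Definition Lx : 'M[K]_d.+1 := \matrix_(i, j)
  (Q ^ (d%:Z - 2 * j%:Z) *: Lvec j%:Z
   + (Q ^ (- d%:Z) - Q ^ (d%:Z - 2 * j%:Z + 2)) *: Lvec (j%:Z - 1)) i 0.
Definition Ly : 'M[K]_d.+1 := \matrix_(i, j)
  (Q ^ (d%:Z - 2 * j%:Z) *: Lvec j%:Z
   + (Q ^ d%:Z - Q ^ (d%:Z - 2 * j%:Z - 2)) *: Lvec (j%:Z + 1)) i 0.
Definition Lz : 'M[K]_d.+1 := \matrix_(i, j)
  (Q ^ (2 * j%:Z - d%:Z) *: Lvec j%:Z) i 0.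

Lemma mulmx_Lvec (F : int -> 'cV[K]_d.+1) (i : int) :
  (i < 0 -> F i = 0) -> (d%:Z < i -> F i = 0) ->
  (\matrix_(k, j) F j%:Z k 0) *m Lvec i = F i.
Proof.
move=> Fneg Fbig; apply/matrixP=> k j; rewrite !ord1 mxE {j}.
have [ile0|i0] := ltP i 0.
  rewrite Fneg // mxE big1 // => j _; rewrite !mxE.
  by case: eqP => [e|_]; [move: ile0; rewrite -e | rewrite mulr0].
have [gid|] := ltP d%:Z i.
  rewrite Fbig // mxE big1 // => j _; rewrite !mxE.
  case: eqP => [e|_]; last by rewrite mulr0.
  by move: gid; rewrite -e ltz_nat ltnNge -ltnS ltn_ord.
case: i i0 {Fneg Fbig} => // n _; rewrite lez_nat -ltnS => nd.
rewrite (bigD1 (Ordinal nd)) //= !mxE eqxx mulr1 big1 ?addr0 // => j.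
rewrite !mxE eqz_nat => jn; case: eqP => [e|_]; last by rewrite mulr0.
by case/eqP: jn; apply: val_inj.
Qed.

Lemma Lvec_out i : (i < 0) || (d%:Z < i) -> Lvec i = 0.
Proof.
move=> io; apply/matrixP=> j k; rewrite !mxE; case: eqP => // e.
move: io; rewrite -e ltz_nat ltNge lez_nat leq0n /= ltnNge -ltnS.
by rewrite ltn_ord.
Qed.

Lemma Lx_vec i : Lx *m Lvec i = Q ^ (d%:Z - 2 * i) *: Lvec i
  + (Q ^ (- d%:Z) - Q ^ (d%:Z - 2 * i + 2)) *: Lvec (i - 1).
Proof.
apply: (mulmx_Lvec (F := fun i => Q ^ (d%:Z - 2 * i) *: Lvec i
  + (Q ^ (- d%:Z) - Q ^ (d%:Z - 2 * i + 2)) *: Lvec (i - 1))) => io.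
  by rewrite !Lvec_out ?scaler0 ?addr0 //; lia.
rewrite [Lvec i]Lvec_out ?io ?orbT // scaler0 add0r.
have [->|id] := eqVneq i (d%:Z + 1).
  by rewrite (_ : _ + 2 = - d%:Z) ?subrr ?scale0r //; lia.
by rewrite Lvec_out ?scaler0 //; lia.
Qed.

Lemma Ly_vec i : Ly *m Lvec i = Q ^ (d%:Z - 2 * i) *: Lvec i
  + (Q ^ d%:Z - Q ^ (d%:Z - 2 * i - 2)) *: Lvec (i + 1).
Proof.
apply: (mulmx_Lvec (F := fun i => Q ^ (d%:Z - 2 * i) *: Lvec i
  + (Q ^ d%:Z - Q ^ (d%:Z - 2 * i - 2)) *: Lvec (i + 1))) => io; last first.
  by rewrite !Lvec_out ?scaler0 ?addr0 //; lia.
rewrite [Lvec i]Lvec_out ?io // scaler0 add0r.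
have [->|id] := eqVneq i (-1).
  by rewrite (_ : _ - 2 = d%:Z) ?subrr ?scale0r //; lia.
by rewrite Lvec_out ?scaler0 //; lia.
Qed.

Lemma Lz_vec i : Lz *m Lvec i = Q ^ (2 * i - d%:Z) *: Lvec i.
Proof.
apply: (mulmx_Lvec (F := fun i => Q ^ (2 * i - d%:Z) *: Lvec i)) => io.
  by rewrite Lvec_out ?scaler0 // io.
by rewrite Lvec_out ?scaler0 // io orbT.
Qed.

Lemma eq_Lvec (A B : 'M[K]_d.+1) :
  (forall i, A *m Lvec i = B *m Lvec i) -> A = B.
Proof.
move=> AB; apply/matrixP=> i j.
have E (C : 'M[K]_d.+1) : (C *m Lvec j%:Z) i 0 = C i j.
  rewrite mxE (bigD1 j) //= !mxE eqxx mulr1 big1 ?addr0 // => k.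
  rewrite !mxE eqz_nat => kj; case: eqP => [e|_]; last by rewrite mulr0.
  by case/eqP: kj; apply: val_inj.
by rewrite -E AB E.
Qed.

Lemma Ly_unit : Ly \in unitmx.
Proof.
rewrite unitmxE det_trig.
  rewrite unitfE; apply/prodf_neq0 => i _; rewrite !mxE eqxx.
  rewrite (_ : (_ == _ + 1) = false) ?mulr0 ?addr0 ?mulr1; last by lia.
  exact/expfz_neq0/nonroot_neq0.
apply/is_trig_mxP => i j ij; rewrite !mxE.
rewrite (_ : (_ == _ + 1) = false) ?mulr0 ?addr0; last by lia.
by rewrite (_ : (_ == _) = false) ?mulr0 //; lia.
Qed.

Lemma L_relations : Uq_relations q Lx Ly (invmx Ly) Lz.
Proof.
have q0 := nonroot_neq0 q; have w := nonroot_subV_neq0 q.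
have expD (n m k : int) : k = n + m -> Q ^ k = Q ^ n * Q ^ m.
  by move=> ->; rewrite expfzDr.
have exp2 : Q ^ (-2 : int) = Q ^- 2 by rewrite -exprnN.
have exp2p : Q ^ (2 : int) = Q ^+ 2 by [].
have expV (n m : int) : m = - n -> Q ^ m = (Q ^ n)^-1.
  by move=> ->; rewrite invr_expz.
have qd0 : Q ^ d%:Z != 0 by apply: expfz_neq0.
have vecE (i j : int) : i = j -> Lvec i = Lvec j by move=> ->.
have toE (A B : 'M[K]_d.+1) : A = B ->
    (Q - Q^-1)^-1 *: A = (Q - Q^-1)^-1 *: B by move=> ->.
have one : 1 = (Q - Q^-1)^-1 *: ((Q - Q^-1) *: 1) :> 'M[K]_d.+1.
  by rewrite scalerA mulVf // scale1r.
split.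
- exact: mulmxV Ly_unit.
- exact: mulVmx Ly_unit.
- rewrite [RHS]one; apply/toE/eq_Lvec => i.
  rewrite mulmxBl -!scalemxAl -!mulmxA mul1mx !(Lx_vec, Ly_vec).
  rewrite !(mulmxDr, =^~ scalemxAr, Lx_vec, Ly_vec).
  rewrite (vecE (i + 1 - 1) i) ?(vecE (i - 1 + 1) i); [|by lia..].
  rewrite (expD (d%:Z - 2 * i) 2 (d%:Z - 2 * i + 2)) //.
  rewrite (expD (d%:Z - 2 * i) (-2) (d%:Z - 2 * i - 2)) //.
  rewrite (expD (d%:Z - 2 * i) 2 (d%:Z - 2 * (i - 1))); last by lia.
  rewrite (expD (d%:Z - 2 * i) (-2) (d%:Z - 2 * (i + 1))); last by lia.
  rewrite (expD (d%:Z - 2 * i) 0 (d%:Z - 2 * (i - 1) - 2)); last by lia.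
  rewrite (expD (d%:Z - 2 * i) 0 (d%:Z - 2 * (i + 1) + 2)); last by lia.
  rewrite exp2 expr0z (expV d%:Z (- d%:Z)) // exp2p.
  have P0 : Q ^ (d%:Z - 2 * i) != 0 by apply: expfz_neq0.
  move: (Q ^ (d%:Z - 2 * i)) P0 (Q ^ d%:Z) qd0 => P P0 D D0.
  by apply/matrixP=> a b; rewrite !mxE; field; rewrite ?q0 ?P0 ?D0.
- rewrite [RHS]one; apply/toE/eq_Lvec => i.
  rewrite mulmxBl -!scalemxAl -!mulmxA mul1mx !(Lz_vec, Ly_vec).
  rewrite !(mulmxDr, =^~ scalemxAr, Lz_vec, Ly_vec).
  rewrite (expD (d%:Z - 2 * i) (-2) (d%:Z - 2 * i - 2)) //.
  rewrite (expD (2 * i - d%:Z) 2 (2 * (i + 1) - d%:Z)); last by lia.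
  rewrite (expV (d%:Z - 2 * i) (2 * i - d%:Z)); last by lia.
  rewrite exp2 exp2p.
  have P0 : Q ^ (d%:Z - 2 * i) != 0 by apply: expfz_neq0.
  move: (Q ^ (d%:Z - 2 * i)) P0 (Q ^ d%:Z) qd0 => P P0 D D0.
  by apply/matrixP=> a b; rewrite !mxE; field; rewrite ?q0 ?P0 ?D0.
- rewrite [RHS]one; apply/toE/eq_Lvec => i.
  rewrite mulmxBl -!scalemxAl -!mulmxA mul1mx !(Lz_vec, Lx_vec).
  rewrite !(mulmxDr, =^~ scalemxAr, Lz_vec, Lx_vec).
  rewrite (expD (d%:Z - 2 * i) 2 (d%:Z - 2 * i + 2)) //.
  rewrite (expD (2 * i - d%:Z) (-2) (2 * (i - 1) - d%:Z)); last by lia.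
  rewrite (expV (d%:Z - 2 * i) (2 * i - d%:Z)); last by lia.
  rewrite exp2 (expV d%:Z (- d%:Z)) // exp2p.
  have P0 : Q ^ (d%:Z - 2 * i) != 0 by apply: expfz_neq0.
  move: (Q ^ (d%:Z - 2 * i)) P0 (Q ^ d%:Z) qd0 => P P0 D D0.
  by apply/matrixP=> a b; rewrite !mxE; field; rewrite ?q0 ?P0 ?D0.
Qed.

End LMatrices.

(* L(d, 1) as a U_q(sl_2)-module. *)
Definition Lmod (K : fieldType) (q : nonroot K) (d : nat) : Type :=
  'cV[K]_d.+1.

Section Lmod.
Variables (K : fieldType) (q : nonroot K) (d : nat).
Local Notation Q := (qval q).
Local Notation L := (Lmod q d).

HB.instance Definition _ := GRing.Zmodule.on L.

Definition Lmod_scale (a : Uq q) (v : L) : L :=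
  Ulift (L_relations q d) a *m (v : 'cV[K]_d.+1).

Lemma Lmod_scaleA a b v : Lmod_scale a (Lmod_scale b v) = Lmod_scale (a * b) v.
Proof. by rewrite /Lmod_scale mulmxA rmorphM. Qed.

Lemma Lmod_scale1 : left_id 1 Lmod_scale.
Proof. by move=> v; rewrite /Lmod_scale rmorph1 mul1mx. Qed.

Lemma Lmod_scaleDr : right_distributive Lmod_scale +%R.
Proof. by move=> a u v; apply: mulmxDr. Qed.

Lemma Lmod_scaleDl v : {morph Lmod_scale^~ v : a b / a + b}.
Proof. by move=> a b; rewrite /Lmod_scale rmorphD; apply: mulmxDl. Qed.

HB.instance Definition _ := GRing.Zmodule_isLmodule.Build (Uq q) L
  Lmod_scaleA Lmod_scale1 Lmod_scaleDr Lmod_scaleDl.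

Definition Lmod_basis (i : int) : L := Lvec K d i.

Lemma Lmod_scalar (c : K) (v : L) : c%:A *: v = c *: (v : 'cV[K]_d.+1).
Proof.
by rewrite [LHS]/(Lmod_scale _ _) /Lmod_scale linearZ /= rmorph1 -scalemxAl
  mul1mx.
Qed.

(* The defining formulas of L(d, 1). They hold for every integer i, since u_i = 0
   outside 0 <= i <= d and the boundary coefficients vanish. *)
Local Notation u := Lmod_basis.

Lemma Lmod_x (i : int) : (Ux q - (Q ^ (d%:Z - 2 * i))%:A) *: u i =
  (Q ^ (- d%:Z) - Q ^ (d%:Z - 2 * i + 2))%:A *: u (i - 1).
Proof.
rewrite scalerBl !Lmod_scalar; apply/eqP; rewrite subr_eq addrC; apply/eqP.
by rewrite [LHS]/(Lmod_scale _ _) /Lmod_scale Ulift_x; apply: Lx_vec.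
Qed.

Lemma Lmod_y (i : int) : (Uy q - (Q ^ (d%:Z - 2 * i))%:A) *: u i =
  (Q ^ d%:Z - Q ^ (d%:Z - 2 * i - 2))%:A *: u (i + 1).
Proof.
rewrite scalerBl !Lmod_scalar; apply/eqP; rewrite subr_eq addrC; apply/eqP.
by rewrite [LHS]/(Lmod_scale _ _) /Lmod_scale Ulift_y; apply: Ly_vec.
Qed.

Lemma Lmod_z (i : int) : Uz q *: u i = (Q ^ (2 * i - d%:Z))%:A *: u i.
Proof.
rewrite Lmod_scalar.
by rewrite [LHS]/(Lmod_scale _ _) /Lmod_scale Ulift_z; apply: Lz_vec.
Qed.

End Lmod.

Definition Ld (K : fieldType) (q : nonroot K) (d : nat) : lmodType (calA q) :=
  restriction (Lmod q d).

Definition Ld_basis (K : fieldType) (q : nonroot K) (d : nat) (i : nat) :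
  Ld q d := Lmod_basis q d i%:Z.

(* Main.v *)
Require Import Defs.
From HB Require Import structures.
From mathcomp Require Import all_boot all_order all_algebra.
From mathcomp Require Import ring zify ssrAC boolp.

(** Everything rests on three of the elements of the algebra A: [nu_x], [nu_y]
   and [z^2].  They satisfy
     z^2 nu_x  = q^4 nu_x z^2,
     nu_y nu_x = q^2 nu_x nu_y - (q^2 - 1) (1 - z^2),
   so they behave like the raising operator, the lowering operator and the
   weight operator of a highest weight theory.  If [v_0] is killed by [nu_y] and
   [z^2 v_0 = c v_0], then the [v_i = nu_x^i v_0] are weight vectors and [nu_y]
   maps [v_{i+1}] to [(1 - q^{2i+2}) (1 - c q^{2i}) v_i] ([z2_weight],
   [ny_weight]).  Applied to [v_{d+1} = 0] and [v_d <> 0], the last formula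
   forces [c = q^{-2d}] because [q] is not a root of unity ([weight_eq]).

   In L(d) the vector [u_0] is annihilated by [nu_y] and has the same weight
   [q^{-2d}], and [nu_x^i u_0 = gamma_i u_i] ([Ld_nu_xX]).  The formulas above
   depend on [c] only, so the K-linear map [g] from L(d) to V that sends
   [nu_x^i u_0] to [nu_x^i v_0] commutes with [nu_x], [nu_y] and [z^2]
   ([transfer_exists]).

   The algebra A is generated by the products of two of x, y, z, and these products
   become polynomials in [nu_x], [nu_y] and [z^2] after multiplication by [z^2]:
   for instance
     xy z^2 = (1 - q nu_y) (1 - q^{-3} nu_x)
   ([xyz2]).  As [z^2] is onto on L(d), the map [g] commutes with all those
   products, hence with A ([intertwiner_scalable]).

   Finally [g] is injective because the [v_i] with [i <= d] are linearly
   independent (apply a power of [nu_x] that leaves only [v_d]), and onto because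
   its image is a nonzero submodule of the irreducible module V.  The isomorphism
   of the theorem is the inverse of [g]. *)

Set Implicit Arguments.
Unset Strict Implicit.
Unset Printing Implicit Defensive.

Import GRing.Theory.
Local Open Scope ring_scope.

(** * The relations between nu_x, nu_y and z *)

(** Cancellation in the expansion of (1 - a)(1 - b), used by [nu_y_nu_x]. *)
Lemma subr_solve (V : zmodType) (o a b p c w t : V) :
  o - a - (b - p) = c - b - (a - w) + t -> w = p - (c - o + t).
Proof.
rewrite !opprB => e.
have -> : w = (c - b + (w - a) + t) - t + a + b - c.
  by rewrite addrK addrA subrK [c - b + w]addrAC subrK [c + w]addrC addrK.
rewrite -e opprD opprB !addrA [LHS](ACl (3*1*8*5*(6*2)*(7*4)))%AC /=.
by rewrite !subrr !addr0.
Qed.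

(** The computations take place in an arbitrary algebra with elements [x], [y], [z]
   that satisfy the relations of U_q(sl_2) in normal-ordering form; [X] and [Y]
   are the elements nu_x and nu_y. *)
Section Relations.
Variables (K : fieldType) (Q : K) (B : algType K) (x y z : B).
Hypothesis Q0 : Q != 0.
Hypothesis yx : y * x = Q ^+ 2 *: (x * y) + (1 - Q ^+ 2) *: 1.
Hypothesis zy : z * y = Q ^+ 2 *: (y * z) + (1 - Q ^+ 2) *: 1.
Hypothesis zx : z * x = Q ^- 2 *: (x * z) + (1 - Q ^- 2) *: 1.
Variables (X Y : B).
Hypothesis XE : X = Q *: (1 - y * z).
Hypothesis YE : Y = Q *: (1 - z * x).

Lemma mul_yz : y * z = 1 - Q^-1 *: X.
Proof. by rewrite XE scalerA mulVf // scale1r subKr. Qed.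

Lemma mul_zx : z * x = 1 - Q^-1 *: Y.
Proof. by rewrite YE scalerA mulVf // scale1r subKr. Qed.

Lemma mul_zy : z * y = 1 - Q *: X.
Proof.
rewrite zy mul_yz scalerBr scalerA expr2 mulfK // scalerBl scale1r.
by rewrite addrC addrA subrK.
Qed.

Lemma mul_xz : x * z = 1 - Q *: Y.
Proof.
have := zx; rewrite mul_zx => /(congr1 (fun u => Q ^+ 2 *: u)).
rewrite scalerBr scalerDr !scalerA mulrBr mulr1 mulfV ?expf_neq0 // scale1r.
rewrite expr2 mulfK // scalerBl scale1r => e.
apply: (addIr ((Q * Q) *: 1 - 1)); rewrite -e.
by rewrite [RHS]addrC addrA subrK.
Qed.

Lemma nu_xE : X = Q^-1 *: (1 - z * y).
Proof. by rewrite mul_zy subKr scalerA mulVf // scale1r. Qed.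

Lemma nu_yE : Y = Q^-1 *: (1 - x * z).
Proof. by rewrite mul_xz subKr scalerA mulVf // scale1r. Qed.

Lemma z_nu_x : z * X = Q ^+ 2 *: (X * z).
Proof.
rewrite {2}nu_xE XE -scalerAl scalerA expr2 mulfK //.
by rewrite -scalerAr mulrBr mulrBl mulr1 mul1r mulrA.
Qed.

Lemma z_nu_y : Y * z = Q ^+ 2 *: (z * Y).
Proof.
rewrite {2}nu_yE YE -scalerAr scalerA expr2 mulfK //.
by rewrite -scalerAl mulrBr mulrBl mulr1 mul1r mulrA.
Qed.

Lemma sqr_z_nu_x : z ^+ 2 * X = Q ^+ 4 *: (X * z ^+ 2).
Proof.
rewrite expr2 -[LHS]mulrA z_nu_x -scalerAr !mulrA z_nu_x -scalerAl scalerA.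
by rewrite -exprD.
Qed.

Let nu_x_z : X * z = Q ^- 2 *: (z * X).
Proof. by rewrite z_nu_x scalerA mulVf ?expf_neq0 // scale1r. Qed.

(** Moving one [z] next to each of the two letters turns both letters into
   polynomials in [X] and [Y]; the powers of [Q] come from commuting the inner [z]
   past [X] or [Y]. *)
Lemma xyz2 : x * y * z ^+ 2 = (1 - Q *: Y) * (1 - Q ^- 3 *: X).
Proof.
rewrite expr2 mulrA -(mulrA x) mul_yz -mulrA mulrBl mul1r -scalerAl nu_x_z.
rewrite scalerA -invfM -exprS.
by rewrite -{1}[z]mulr1 scalerAr -mulrBr mulrA mul_xz.
Qed.

Lemma yyz2 : y * y * z ^+ 2 = (1 - Q^-1 *: X) * (1 - Q ^- 3 *: X).
Proof.
rewrite expr2 mulrA -(mulrA y) mul_yz -mulrA mulrBl mul1r -scalerAl nu_x_z.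
rewrite scalerA -invfM -exprS.
by rewrite -{1}[z]mulr1 scalerAr -mulrBr mulrA mul_yz.
Qed.

Lemma xxz2 : x * x * z ^+ 2 = (1 - Q *: Y) * (1 - Q ^+ 3 *: Y).
Proof.
rewrite expr2 mulrA -(mulrA x) mul_xz -mulrA mulrBl mul1r -scalerAl z_nu_y.
rewrite scalerA -exprS.
by rewrite -{1}[z]mulr1 scalerAr -mulrBr mulrA mul_xz.
Qed.

(** Multiply the relation between [x] and [y] by [z] on both sides: then zyxz and
   zxyz are products of two factors zy, xz and zx, yz, which are affine in [X] and
   [Y]. *)
Lemma nu_y_nu_x :
  Y * X = Q ^+ 2 *: (X * Y) - (Q ^+ 2 - 1) *: (1 - z ^+ 2).
Proof.
have := congr1 (fun u => z * u * z) yx.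
rewrite mulrDr mulrDl -!scalerAr -!scalerAl mulr1 -expr2 !mulrA.
rewrite mul_zy mul_zx -!mulrA mul_xz mul_yz !mulrBr !mulrBl !mulr1 !mul1r.
rewrite -!scalerAr -!scalerAl !scalerBr !scalerA.
(* The terms linear in [X] and in [Y] agree on the two sides. *)
have -> : Q ^+ 2 / Q = Q by rewrite expr2 mulfK.
rewrite mulfV // scale1r => /subr_solve ->.
congr (_ - _); rewrite [(Q ^+ 2 - 1)%:A]scalerBl scale1r.
by rewrite -[1 - Q ^+ 2]opprB scaleNr.
Qed.

End Relations.

(** * Generation of A and intertwiners *)

Section CalARelations.
Variables (K : fieldType) (q : nonroot K).
Local Notation Q := (qval q).
Local Notation x := (Ux q).
Local Notation y := (Uy q).
Local Notation z := (Uz q).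
Local Notation nx := (nu_x q).
Local Notation ny := (nu_y q).
Local Notation z2 := (sqr_z q).

Lemma calA_z2_nx : z2 * nx = Q ^+ 4 *: (nx * z2).
Proof.
apply: val_inj.
exact: (sqr_z_nu_x (nonroot_neq0 q) (Uzy q) (erefl (val nx))).
Qed.

Lemma calA_ny_nx : ny * nx = Q ^+ 2 *: (nx * ny) - (Q ^+ 2 - 1) *: (1 - z2).
Proof.
apply: val_inj.
exact: (nu_y_nu_x (nonroot_neq0 q) (Uyx q) (Uzy q) (Uzx q)
  (erefl (val nx)) (erefl (val ny))).
Qed.

(** Induction along products of two generators: a monomial x^r y^s z^t of even
   degree is a word of even length, and its letters can be grouped in pairs. *)
Lemma calA_pair_ind (P : calA q -> Prop) :
  P 1 -> (forall c a b, P a -> P b -> P (c *: a + b)) ->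
  (forall a b, P a -> P b -> P (a * b)) ->
  (forall u v a, u \in [:: x; y; z] -> v \in [:: x; y; z] ->
     val a = u * v -> P a) ->
  forall a, P a.
Proof.
move=> P1 Plin Pmul Ppair.
have Pword n (s : seq (Uq q)) : size s = n.*2 -> {subset s <= [:: x; y; z]} ->
    exists2 a : calA q, val a = \prod_(u <- s) u & P a.
  elim: n s => [|n IHn] [|u [|v s]] //=.
    by move=> _ _; exists 1; rewrite ?big_nil.
  move=> [size_s] sub_s.
  have [||b bE Pb] := IHn s => //.
    by move=> w ws; apply: sub_s; rewrite !inE ws !orbT.
  have us : u \in [:: x; y; z] by apply: sub_s; rewrite inE eqxx.
  have vs : v \in [:: x; y; z] by apply: sub_s; rewrite !inE eqxx orbT.
  exists (Sub (u * v) (Apred_mon2 us vs) * b).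
    by rewrite !big_cons mulrA -bE.
  by apply: Pmul Pb; apply: (Ppair u v).
have Pmon m : ~~ odd (deg3 m) -> exists2 a : calA q, val a = Umon q m & P a.
  case: m => [[r s] t] /= /even_halfK e.
  have size_s : size (nseq r x ++ nseq s y ++ nseq t z) = (r + s + t)./2.*2.
    by rewrite !size_cat !size_nseq addnA e.
  have [|a aE Pa] := Pword _ _ size_s.
    move=> u; rewrite !mem_cat !mem_nseq !inE.
    by case/or3P=> /andP[_ ->]; rewrite ?orbT.
  exists a => //; rewrite aE !big_cat !big_nseq /= mulrA.
  by rewrite !iter_mulr_1.
have P0 : P 0 by rewrite -[0](addNr 1) -scaleN1r; apply: Plin.
move=> a; have /asboolP[l aE] := valP a.
suff [b bE Pb] : exists2 b : calA q, val b = val a & P b.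
  by rewrite -(val_inj bE).
rewrite {}aE; elim: l => [|[c m] l [b bE Pb]].
  by exists 0; rewrite ?big_nil.
rewrite big_cons /=; case: eqP => [/negbT m_even|_]; last by exists b.
have [a' a'E Pa'] := Pmon m m_even.
by exists (c *: a' + b); [rewrite -a'E -bE | apply: Plin].
Qed.

Section Intertwiner.
Variables (M N : lmodType (calA q)) (g : M -> N).
Hypothesis gD : {morph g : v w / v + w}.
Hypothesis gZ : forall (c : K) v, g (c%:A *: v) = c%:A *: g v.
Hypothesis g_nx : forall v, g (nx *: v) = nx *: g v.
Hypothesis g_ny : forall v, g (ny *: v) = ny *: g v.
Hypothesis g_z2 : forall v, g (z2 *: v) = z2 *: g v.
Hypothesis z2_surj : forall v : M, exists w, v = z2 *: w.

(** If [a * z2] is a polynomial in [nx] and [ny], then [g] commutes with [a], since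
   every vector is in the image of [z2].  This settles xx, xy and yy; the other
   products of two generators are affine in one of these, in [nx], in [ny] or in
   [z2]. *)
Lemma intertwiner_scalable : scalable g.
Proof.
pose P (a : calA q) := forall v, g (a *: v) = a *: g v.
have P1 : P 1 by move=> v; rewrite !scale1r.
have Plin c a b : P a -> P b -> P (c *: a + b).
  move=> Pa Pb v; rewrite !scalerDl gD Pb -[c *: a]mulr_algl -!scalerA gZ.
  by rewrite Pa.
have P0 : P 0 by have := Plin (-1) 1 1 P1 P1; rewrite scaleN1r addNr.
have Pmul a b : P a -> P b -> P (a * b).
  by move=> Pa Pb v; rewrite -!scalerA Pa Pb.
have Psub c a : P a -> P (1 - c *: a).
  by move=> Pa; rewrite addrC -scaleNr; apply: Plin.
have Pdiv a b : a * z2 = b -> P b -> P a.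
  move=> abE Pb v; have [w ->] := z2_surj v.
  by rewrite scalerA abE Pb -abE -scalerA g_z2.
have q0 := nonroot_neq0 q.
pose A u v us vs : calA q := Sub (u * v) (@Apred_mon2 _ q u v us vs).
have [xl yl] : x \in [:: x; y; z] /\ y \in [:: x; y; z].
  by rewrite !inE !eqxx !orbT.
have Pxy : P (A _ _ xl yl).
  apply: Pdiv (Pmul _ _ (Psub Q _ g_ny) (Psub (Q ^- 3) _ g_nx)).
  apply: val_inj.
  exact: (xyz2 q0 (Uzy q) (Uzx q) (erefl (val nx)) (erefl (val ny))).
apply: (calA_pair_ind (P := P)) => // u v a.
rewrite !inE => /or3P[]/eqP-> /or3P[]/eqP-> aE.
- apply: Pdiv (Pmul _ _ (Psub Q _ g_ny) (Psub (Q ^+ 3) _ g_ny)).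
  apply: val_inj.
  exact: etrans (congr1 ( *%R^~ (z ^+ 2)) aE) (xxz2 q0 (Uzx q) (erefl (val ny))).
- by rewrite (_ : a = A _ _ xl yl) //; apply: val_inj.
- rewrite (_ : a = 1 - Q *: ny); first exact: Psub.
  apply: val_inj; exact: etrans aE (mul_xz q0 (Uzx q) (erefl (val ny))).
- rewrite (_ : a = Q ^+ 2 *: A _ _ xl yl + ((1 - Q ^+ 2) *: 1 + 0)).
    exact: Plin Pxy (Plin _ _ _ P1 P0).
  by apply: val_inj; rewrite addr0; exact: etrans aE (Uyx q).
- apply: Pdiv (Pmul _ _ (Psub Q^-1 _ g_nx) (Psub (Q ^- 3) _ g_nx)).
  apply: val_inj.
  exact: etrans (congr1 ( *%R^~ (z ^+ 2)) aE) (yyz2 q0 (Uzy q) (erefl (val nx))).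
- rewrite (_ : a = 1 - Q^-1 *: nx); first exact: Psub.
  apply: val_inj; exact: etrans aE (mul_yz q0 (erefl (val nx))).
- rewrite (_ : a = 1 - Q^-1 *: ny); first exact: Psub.
  apply: val_inj; exact: etrans aE (mul_zx q0 (erefl (val ny))).
- rewrite (_ : a = 1 - Q *: nx); first exact: Psub.
  apply: val_inj; exact: etrans aE (mul_zy q0 (Uzy q) (erefl (val nx))).
- rewrite (_ : a = z2) //; exact: val_inj.
Qed.

End Intertwiner.

End CalARelations.

(** * Scalars acting through an algebra *)

Section ScalarAction.
Variables (K : fieldType) (A : algType K) (M : lmodType A).
Implicit Types (k l : K) (a : A) (v : M).

Lemma scale_algC k a v : a *: (k%:A *: v) = k%:A *: (a *: v).
Proof. by rewrite !scalerA mulr_algl mulr_algr. Qed.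

Lemma scale_scale k a v : (k *: a) *: v = k%:A *: (a *: v).
Proof. by rewrite scalerA mulr_algl. Qed.

Lemma scale_algM k l v : k%:A *: (l%:A *: v) = (k * l)%:A *: v.
Proof. by rewrite scalerA mulr_algl scalerA. Qed.

Lemma scale_algB k l v : (k - l)%:A *: v = k%:A *: v - l%:A *: v.
Proof. by rewrite !scalerBl. Qed.

Lemma scale_algD k l v : (k + l)%:A *: v = k%:A *: v + l%:A *: v.
Proof. by rewrite !scalerDl. Qed.

Lemma scale_alg1 v : (1 : K)%:A *: v = v.
Proof. by rewrite !scale1r. Qed.

Lemma scale_alg_eq0 k v : v != 0 -> k%:A *: v = 0 -> k = 0.
Proof.
move=> v0 kv0; apply/eqP; apply: contraNT v0 => k0.
by rewrite -[v]scale_alg1 -(mulVf k0) -scale_algM kv0 scaler0.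
Qed.

End ScalarAction.

(** * Highest weight vectors *)

(** The formulas follow from the two commutation rules alone, which is why [nx],
   [ny] and [z2] live in an arbitrary algebra. *)
Section HighestWeight.
Variables (K : fieldType) (Q : K) (A : algType K) (nx ny z2 : A).
Hypothesis z2_nx : z2 * nx = Q ^+ 4 *: (nx * z2).
Hypothesis ny_nx : ny * nx = Q ^+ 2 *: (nx * ny) - (Q ^+ 2 - 1) *: (1 - z2).
Variables (M : lmodType A) (m0 : M) (c : K).
Hypothesis ny_m0 : ny *: m0 = 0.
Hypothesis z2_m0 : z2 *: m0 = c%:A *: m0.
Local Notation v i := (nx ^+ i *: m0).

Let vS i : v i.+1 = nx *: v i.
Proof. by rewrite exprS scalerA. Qed.

Lemma z2_weight i : z2 *: v i = (Q ^+ (4 * i) * c)%:A *: v i.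
Proof.
elim: i => [|i IHi]; first by rewrite muln0 mul1r expr0 scale1r.
rewrite vS scalerA z2_nx scale_scale -scalerA IHi.
by rewrite scale_algC scale_algM mulrA mulnS exprD.
Qed.

Definition ny_coef i := (1 - Q ^+ (2 * i.+1)) * (1 - c * Q ^+ (2 * i)).

(** The commutation rule gives a first-order recursion with [Q ^+ 2] for ratio;
   [ny_coef] is its solution that starts from [ny *: m0 = 0]. *)
Lemma ny_weight i : ny *: v i.+1 = (ny_coef i)%:A *: v i.
Proof.
have step j : ny *: v j.+1 = (Q ^+ 2)%:A *: (nx *: (ny *: v j))
     - ((Q ^+ 2 - 1) * (1 - Q ^+ (4 * j) * c))%:A *: v j.
  rewrite vS scalerA ny_nx scalerBl.
  rewrite (scale_scale _ (nx * ny)) (scale_scale _ (1 - z2)).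
  rewrite [(1 - z2) *: _]scalerBl scale1r z2_weight.
  by rewrite -scalerA -(scale_algM (Q ^+ 2 - 1)) (scale_algB 1) scale_alg1.
elim: i => [|i IHi]; rewrite step.
  rewrite expr0 scale1r ny_m0 !scaler0 sub0r -scaleNr -scaleNr.
  by congr (_%:A *: _); rewrite /ny_coef; ring.
rewrite IHi scale_algC -vS scale_algM -scale_algB.
congr (_%:A *: _); rewrite /ny_coef.
have -> : Q ^+ (4 * i.+1) = (Q ^+ 2 * Q ^+ (2 * i)) ^+ 2.
  by rewrite -exprD -exprM; congr (Q ^+ _); lia.
have e j : Q ^+ (2 * j.+1) = Q ^+ 2 * Q ^+ (2 * j) by rewrite mulnS exprD.
by rewrite !e; ring.
Qed.

Section Free.
Variable (d : nat).
Definition lincomb (c : 'I_d.+1 -> K) : M := \sum_j (c j)%:A *: v j.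

Lemma lincombP k a b :
  lincomb (fun j => k * a j + b j) = k%:A *: lincomb a + lincomb b.
Proof.
rewrite /lincomb scaler_sumr -big_split; apply: eq_bigr => j _ /=.
by rewrite scale_algD scale_algM.
Qed.

Hypothesis vd_neq0 : v d != 0.
Hypothesis vd1_eq0 : v d.+1 = 0.

Lemma power_eq0 i : (d < i)%N -> v i = 0.
Proof.
by move=> /subnK <-; rewrite exprD -scalerA vd1_eq0 scaler0.
Qed.

(** If [a j] is the first nonzero coefficient, then applying [nx ^+ (d - j)] leaves
   only the multiple [a j] of [nx ^+ d *: m0]. *)
Lemma lincomb_free a : lincomb a = 0 -> forall j, a j = 0.
Proof.
move=> a0; suff H n : forall j : 'I_d.+1, (j < n)%N -> a j = 0.
  by move=> j; apply: (H d.+1).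
elim: n => [|n IHn] // j; rewrite ltnS leq_eqVlt => /predU1P[jn|]; last exact: IHn.
apply: (@scale_alg_eq0 _ _ _ _ _ vd_neq0).
have := congr1 (fun u => nx ^+ (d - j) *: u) a0.
rewrite scaler0 /lincomb scaler_sumr (bigD1 j) //= big1 => [|k kj].
  by rewrite addr0 scale_algC scalerA -exprD subnK // -ltnS.
have [kn|nk] := ltnP k n; first by rewrite IHn // scale0r scale0r scaler0.
have jk : (j < k)%N by rewrite ltn_neqAle jn nk andbT -jn eq_sym.
rewrite scale_algC scalerA -exprD power_eq0 ?scaler0 //.
by rewrite -ltn_subLR ?leq_subr // subKn // -ltnS.
Qed.

(** The chain stops at [d], so the lowering coefficient from [d.+1] to [d] vanishes;
   its factor [1 - Q ^+ (2 * d.+1)] does not. *)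
Lemma weight_eq : (forall n, (0 < n)%N -> Q ^+ n != 1) -> c * Q ^+ (2 * d) = 1.
Proof.
move=> Qnu.
have := ny_weight d; rewrite vd1_eq0 scaler0 => /esym.
move/(scale_alg_eq0 vd_neq0)/eqP; rewrite mulf_eq0 !subr_eq0 eq_sym.
by rewrite (negbTE (Qnu _ _)) //= => /eqP.
Qed.

End Free.

End HighestWeight.

(** * Comparing two modules generated by a vector of the same weight *)

Section Transfer.
Variables (K : fieldType) (Q : K) (A : algType K) (nx ny z2 : A).
Hypothesis Q0 : Q != 0.
Hypothesis z2_nx : z2 * nx = Q ^+ 4 *: (nx * z2).
Hypothesis ny_nx : ny * nx = Q ^+ 2 *: (nx * ny) - (Q ^+ 2 - 1) *: (1 - z2).
Variables (M N : lmodType A) (m0 : M) (n0 : N) (c : K) (d : nat).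
Hypothesis c0 : c != 0.
Hypothesis ny_m0 : ny *: m0 = 0.
Hypothesis z2_m0 : z2 *: m0 = c%:A *: m0.
Hypothesis ny_n0 : ny *: n0 = 0.
Hypothesis z2_n0 : z2 *: n0 = c%:A *: n0.
Hypothesis md_neq0 : nx ^+ d *: m0 != 0.
Hypothesis md1_eq0 : nx ^+ d.+1 *: m0 = 0.
Hypothesis nd1_eq0 : nx ^+ d.+1 *: n0 = 0.
Hypothesis M_spanned :
  forall w : M, exists a : 'I_d.+1 -> K, w = lincomb nx m0 a.

Lemma z2_onto (w : M) : exists w', w = z2 *: w'.
Proof.
have [a ->] := M_spanned w.
exists (lincomb nx m0 (fun j => a j / (Q ^+ (4 * j) * c))).
rewrite /lincomb scaler_sumr; apply: eq_bigr => j _.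
rewrite scale_algC (z2_weight z2_nx z2_m0) scale_algM divfK //.
by rewrite mulf_neq0 ?expf_neq0.
Qed.

(** The map [g] sends [nx ^+ i *: m0] to [nx ^+ i *: n0]; this is well defined since
   the former vectors are independent.  It commutes with the three operators
   because their formulas on these vectors involve only [Q] and the weight [c]. *)
Lemma transfer_exists : exists g : M -> N,
  [/\ {morph g : v w / v + w},
      forall (k : K) v, g (k%:A *: v) = k%:A *: g v,
      forall t, t \in [:: nx; ny; z2] -> forall v, g (t *: v) = t *: g v,
      forall v, g v = 0 -> nx ^+ d *: n0 != 0 -> v = 0 &
      forall i, g (nx ^+ i *: m0) = nx ^+ i *: n0].
Proof.
have [co coE] := choice M_spanned.
pose g w := lincomb nx n0 (co w).
have gE (a : 'I_d.+1 -> K) : g (lincomb nx m0 a) = lincomb nx n0 a.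
  rewrite /g; suff -> : co (lincomb nx m0 a) = a by [].
  apply: funext => j; apply/eqP; rewrite -subr_eq0.
  have /(lincomb_free md_neq0 md1_eq0)/(_ j) :
      lincomb nx m0 (fun j => -1 * a j + co (lincomb nx m0 a) j) = 0.
    by rewrite lincombP -coE scaleN1r scaleN1r addNr.
  by rewrite mulN1r addrC => ->.
have g_lin k v w : g (k%:A *: v + w) = k%:A *: g v + g w.
  by rewrite {1}(coE v) {1}(coE w) -lincombP gE lincombP.
have gD : {morph g : v w / v + w}.
  by move=> v w; have := g_lin 1 v w; rewrite !scale_alg1.
have g0 : g 0 = 0 by apply: (addrI (g 0)); rewrite -gD !addr0.
have gZ (k : K) v : g (k%:A *: v) = k%:A *: g v.
  by have := g_lin k v 0; rewrite g0 !addr0.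
have g_v i : g (nx ^+ i *: m0) = nx ^+ i *: n0.
  have [id|di] := leqP i d; last by rewrite !(power_eq0 _ di) ?g0.
  pose a (j : 'I_d.+1) : K := (j == i :> nat)%:R.
  have aE (P : lmodType A) (p0 : P) : lincomb nx p0 a = nx ^+ i *: p0.
    rewrite /lincomb (bigD1 (Ordinal (id : (i < d.+1)%N))) //= big1.
      by rewrite /a eqxx scale_alg1 addr0.
    by move=> j /negbTE ji; rewrite /a -val_eqE /= in ji *; rewrite ji !scale0r.
  by rewrite -!aE gE.
have g_act t : (forall i, g (t *: (nx ^+ i *: m0)) = t *: (nx ^+ i *: n0)) ->
    forall v, g (t *: v) = t *: g v.
  move=> tv v; rewrite (coE v) gE /lincomb !scaler_sumr (big_morph g gD g0).
  by apply: eq_bigr => j _; rewrite !scale_algC gZ tv.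
exists g; split=> // [t|v gv nd].
  rewrite !inE => /or3P[]/eqP->; apply: g_act => i.
  - by rewrite !scalerA -exprS g_v.
  - case: i => [|i]; first by rewrite !expr0 !scale1r ny_m0 ny_n0.
    rewrite (ny_weight z2_nx ny_nx ny_m0 z2_m0) gZ g_v.
    by rewrite (ny_weight z2_nx ny_nx ny_n0 z2_n0).
  - by rewrite (z2_weight z2_nx z2_m0) (z2_weight z2_nx z2_n0) gZ g_v.
have /(lincomb_free nd nd1_eq0) co0 : lincomb nx n0 (co v) = 0 by [].
by rewrite (coE v) /lincomb big1 // => j _; rewrite co0 !scale0r.
Qed.

End Transfer.

(** * The module L(d) *)

(** With [t = z], [r = y] gives the action of nu_x on a basis vector, and [r = x]
   that of nu_y; [a] and [b] are the inverse diagonal entries of the two operators,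
   so that the diagonal term cancels. *)
Section BasisVector.
Variables (K : fieldType) (B : algType K) (M : lmodType B).
Variables (r s t : B) (u u' : M) (a b e : K).
Hypothesis t_u : t *: u = a%:A *: u.
Hypothesis r_u : (r - b%:A) *: u = e%:A *: u'.
Hypothesis ab1 : a * b = 1.

Lemma act_eq : r *: u = b%:A *: u + e%:A *: u'.
Proof. by move/eqP: r_u; rewrite scalerBl subr_eq addrC => /eqP. Qed.

Lemma raise_action k :
  (k *: (1 - r * t)) *: u = (- (k * a * e))%:A *: u'.
Proof.
rewrite scale_scale scalerBl scale1r -scalerA t_u scale_algC act_eq.
rewrite [a%:A *: _]scalerDr !(scale_algM a) ab1 scale_alg1.
rewrite opprD addrA subrr add0r.
by rewrite scalerN scale_algM mulrA !scaleNr.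
Qed.

Lemma lower_action0 k : u' = 0 -> (k *: (1 - t * r)) *: u = 0.
Proof.
move=> u'0; rewrite scale_scale scalerBl scale1r -scalerA act_eq u'0.
rewrite scaler0 addr0 scale_algC t_u scale_algM mulrC ab1 scale_alg1.
by rewrite subrr scaler0.
Qed.

Lemma sqr_action : t ^+ 2 *: u = (a ^+ 2)%:A *: u.
Proof. by rewrite expr2 -scalerA t_u scale_algC t_u scale_algM. Qed.

End BasisVector.

Section Ld.
Variables (K : fieldType) (q : nonroot K) (d : nat).
Local Notation Q := (qval q).
Local Notation u := (@Ld_basis K q d).
Local Notation Q0 := (nonroot_neq0 q).

Lemma Ld_algE (c : K) (w : Ld q d) : c%:A *: w = c *: (w : 'cV[K]_d.+1).
Proof.
rewrite [LHS]/(restr_scale _ _) /restr_scale.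
rewrite -[RHS](@Lmod_scalar K q d).
by congr (_ *: _); rewrite linearZ rmorph1.
Qed.

Lemma Ld_nu_x i : nu_x q *: u i = (Q^-1 * (1 - Q ^+ (2 * i.+1)))%:A *: u i.+1.
Proof.
have q0 : Q != 0 := Q0.
have ab : Q ^ (2 * i%:Z - d%:Z) * Q ^ (d%:Z - 2 * i%:Z) = 1.
  by rewrite -expfzDr // (_ : _ + _ = 0 :> int) ?expr0z //; lia.
have := raise_action (Lmod_z q d i) (Lmod_y q d i) ab Q.
rewrite (_ : i%:Z + 1 = i.+1%:Z); last by lia.
move=> e; rewrite Ld_algE -(@Lmod_scalar K q d).
apply: etrans e _; congr (_%:A *: _).
rewrite -mulrA mulrBr -!expfzDr //.
rewrite (_ : _ - _ + d%:Z = (2 * i)%N%:Z); last by lia.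
rewrite (_ : _ - d%:Z + (_ - _) = - 2%:Z); last by lia.
rewrite -exprnN mulnS exprD -exprnP.
by field.
Qed.

Lemma Ld_nu_y0 : nu_y q *: u 0 = 0.
Proof.
have ab : Q ^ (2 * 0 - d%:Z) * Q ^ (d%:Z - 2 * 0) = 1.
  by rewrite -expfzDr ?Q0 // (_ : _ + _ = 0 :> int) ?expr0z //; lia.
apply: (lower_action0 (Lmod_z q d 0) (Lmod_x q d 0) ab).
exact: Lvec_out.
Qed.

Lemma Ld_sqr_z0 : sqr_z q *: u 0 = (Q ^- (2 * d))%:A *: u 0.
Proof.
rewrite Ld_algE -(@Lmod_scalar K q d).
apply: etrans (sqr_action (Lmod_z q d 0)) _; congr (_%:A *: _).
by rewrite mulr0 sub0r -exprnN mulnC exprM exprVn.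
Qed.

Variable gamma : nat -> K.
Hypothesis gamma0 : gamma 0%N = 1.
Hypothesis gammaS : forall i : nat, (i < d)%N ->
  gamma i.+1 / gamma i = Q^-1 * (1 - Q ^+ (2 * i.+1)).

Lemma gamma_neq0 i : (i <= d)%N -> gamma i != 0.
Proof.
case: i => [|i] id; first by rewrite gamma0 oner_neq0.
have: gamma i.+1 / gamma i != 0.
  rewrite gammaS // mulf_neq0 ?invr_neq0 ?Q0 // subr_eq0 eq_sym.
  exact: nonroot_expn.
by apply: contraNneq => ->; rewrite mul0r.
Qed.

Lemma Ld_nu_xX i : (i <= d)%N -> nu_x q ^+ i *: u 0 = (gamma i)%:A *: u i.
Proof.
elim: i => [|i IHi] id; first by rewrite gamma0 expr0 scale_alg1 scale1r.
rewrite exprS -[LHS]scalerA IHi 1?ltnW // scale_algC Ld_nu_x scale_algM.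
by rewrite -gammaS // mulrC divfK ?gamma_neq0 // ltnW.
Qed.

Lemma Ld_nu_xX_out : nu_x q ^+ d.+1 *: u 0 = 0.
Proof.
rewrite exprS -[LHS]scalerA Ld_nu_xX // scale_algC Ld_nu_x.
rewrite [u d.+1]Lvec_out; first by rewrite !scaler0.
by lia.
Qed.

Lemma Ld_nu_xd_neq0 : nu_x q ^+ d *: u 0 != 0.
Proof.
rewrite Ld_nu_xX // Ld_algE; apply/eqP => /colP/(_ ord_max)/eqP.
by rewrite !mxE eqxx mulr1; apply/negP/gamma_neq0.
Qed.

Lemma Ld_spanned (w : Ld q d) :
  exists a : 'I_d.+1 -> K, w = lincomb (nu_x q) (u 0) a.
Proof.
exists (fun j => (w : 'cV[K]_d.+1) j 0 / gamma j).
rewrite /lincomb.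
under eq_bigr => j _.
  rewrite Ld_nu_xX -1?ltnS // scale_algM divfK; last first.
    by rewrite gamma_neq0 // -ltnS.
  over.
have wE : (w : 'cV[K]_d.+1) = \sum_(j < d.+1) w j 0 *: Lvec K d j%:Z.
  apply/colP => i; rewrite summxE (bigD1 i) //= !mxE eqxx mulr1 big1 ?addr0 //.
  move=> j ji; rewrite !mxE eqz_nat; case: eqP => [e|_]; last by rewrite mulr0.
  by case/eqP: ji; apply: val_inj.
apply: etrans wE _; apply: eq_bigr => j _.
by rewrite Ld_algE.
Qed.

End Ld.

(** * The isomorphism *)

Theorem theorem8p9 (K : fieldType) (q : nonroot K) (V : lmodType (calA q))
    (finV : finite_dimensional V) (irrV : irreducible_module V)
    (v0 : V) (v0_neq0 : v0 != 0)
    (nu_y_v0 : nu_y q *: v0 = 0)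
    (z2_v0 : eigenvector (sqr_z q) v0)
    (nu_yx_v0 : eigenvector (nu_y q * nu_x q) v0)
    (d : nat)
    (vd_neq0 : nu_x q ^+ d *: v0 != 0)
    (d_max : forall i : nat, nu_x q ^+ i *: v0 != 0 -> (i <= d)%N)
    (gamma : nat -> K)
    (gamma0 : gamma 0%N = 1)
    (gammaS : forall i : nat, (i < d)%N ->
       gamma i.+1 / gamma i = (qval q)^-1 * (1 - qval q ^+ (2 * i.+1))) :
  exists f : {linear V -> Ld q d},
    bijective f /\
    forall i : nat, (i <= d)%N ->
      f (nu_x q ^+ i *: v0) = (gamma i)%:A *: Ld_basis q d i.
Proof.
have [_ [c z2_c]] := z2_v0.
have q0 := nonroot_neq0 q.
have z2_nx := calA_z2_nx q; have ny_nx := calA_ny_nx q.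
have vd1_eq0 : nu_x q ^+ d.+1 *: v0 = 0.
  by apply/eqP/contraT => /d_max; rewrite ltnn.
have cE : c = qval q ^- (2 * d).
  have := weight_eq z2_nx ny_nx nu_y_v0 z2_c vd_neq0 vd1_eq0 (@nonroot_expn K q).
  by move=> e; rewrite -[RHS]mul1r -e mulfK // expf_neq0.
have c0 : c != 0 by rewrite cE invr_eq0 expf_neq0.
have z2_u0 := Ld_sqr_z0 q d; rewrite -cE in z2_u0.
have ud_neq0 := Ld_nu_xd_neq0 gamma0 gammaS.
have ud1_eq0 := Ld_nu_xX_out gamma0 gammaS.
have spanned := Ld_spanned gamma0 gammaS.
have [g [gD gZ g_gen g_inj g_v]] := transfer_exists z2_nx ny_nx
  (Ld_nu_y0 q d) z2_u0 nu_y_v0 z2_c ud_neq0 ud1_eq0 vd1_eq0 spanned.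
have g_scal : scalable g.
  apply: intertwiner_scalable => //.
  - by apply: g_gen; rewrite !inE eqxx.
  - by apply: g_gen; rewrite !inE eqxx orbT.
  - by apply: g_gen; rewrite !inE eqxx !orbT.
  - move=> v; have [w wE] := z2_onto q0 z2_nx c0 z2_u0 spanned v.
    by exists w; exact: wE.
have g_lin a u w : g (a *: u + w) = a *: g u + g w by rewrite gD g_scal.
(* The image of [g] is a submodule that contains [v0]. *)
have g_onto v : exists w, g w = v.
  pose W : {pred V} := [pred v | `[< exists w, g w = v >]].
  have W_closed : submod_closed W.
    split; first by apply/asboolP; exists 0; rewrite -[0](scale0r 0) g_scal scale0r.
    move=> a _ _ /asboolP[u <-] /asboolP[w <-].
    by apply/asboolP; exists (a *: u + w).
  have [_ /(_ W W_closed)[W0|WT]] := irrV; last exact/asboolP/WT.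
  case/eqP: v0_neq0; apply: W0; apply/asboolP.
  by exists (Ld_basis q d 0); have := g_v 0%N; rewrite !expr0 !scale1r.
have [f fK] := choice g_onto.
have gK : cancel g f.
  move=> w; apply/eqP; rewrite -subr_eq0; apply/eqP; apply: g_inj => //.
  by rewrite gD fK -scaleN1r g_scal scaleN1r subrr.
have f_lin a v w : f (a *: v + w) = a *: f v + f w.
  by rewrite -[RHS]gK g_lin !fK.
pose F : {linear V -> Ld q d} :=
  HB.pack f (GRing.isLinear.Build (calA q) V (Ld q d) *:%R f f_lin).
exists F; split; first by exists g.
by move=> i id; rewrite -(Ld_nu_xX gamma0 gammaS id) -g_v; apply: gK.
Qed.
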